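(* Let $(X,d)$ be a metric space. A sequence $(x_n)$ in $X$ is Bourbaki quasi-Cauchy in $X$ if and only if $(x_n)$ is a subsequence of some quasi-Cauchy sequence of $X$.
   Context: Let $(X,d)$ be a metric space. A sequence $(x_n)$ in $X$ is quasi-Cauchy if for every $\varepsilon>0$ there is $n_0\in\mathbb{N}$ such that $d(x_{n+1},x_n)<\varepsilon$ for all $n\ge n_0$. $B_\varepsilon(x)$ is the open ball with centre $x$ and radius $\varepsilon>0$; for $A\subseteq X$, $A^{\varepsilon}=\bigcup_{x\in A}B_\varepsilon(x)$. Put $B^1_\varepsilon(x)=B_\varepsilon(x)$, $B^n_\varepsilon(x)=(B^{n-1}_\varepsilon(x))^{\varepsilon}$ for $n\ge 2$, and $B^\infty_\varepsilon(x)=\bigcup_{n\in\mathbb{N}}B^n_\varepsilon(x)$ (the set of points that can be joined to $x$ by a finite chain in $X$ whose consecutive points are at distance $<\varepsilon$). A sequence $(x_n)$ is Bourbaki quasi-Cauchy in $X$ if for every $\varepsilon>0$ there exist $n_0\in\mathbb{N}$ and $p\in X$ such that $x_n\in B^\infty_\varepsilon(p)$ for every $n\ge n_0$. *)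

(* Defs.v *)
From mathcomp Require Import all_boot all_order all_algebra.
From mathcomp Require Import all_classical all_reals all_analysis.

Set Implicit Arguments.
Unset Strict Implicit.
Unset Printing Implicit Defensive.

Import Order.TTheory GRing.Theory Num.Theory.

Local Open Scope classical_set_scope.
Local Open Scope ring_scope.

Definition quasi_cauchy (R : realType) (X : metricType R) (x : nat -> X) : Prop :=
  forall e : R, 0 < e ->
    exists n0 : nat, forall n : nat, (n0 <= n)%N -> mdist (x n.+1) (x n) < e.

Definition enlargement (R : realType) (X : metricType R) (e : R) (A : set X) : set X :=
  \bigcup_(a in A) ball a e.

(* [iterated_ball e n x] is $B^n_e(x)$, meaningful for n >= 1: the case n = 1
   is the ball itself (and n = 0 is a junk value, also equal to the ball). *)
Definition iterated_ball (R : realType) (X : metricType R) (e : R) (n : nat) (x : X) :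
    set X :=
  iter n.-1 (@enlargement R X e) (ball x e).

Definition infinite_ball (R : realType) (X : metricType R) (e : R) (x : X) : set X :=
  \bigcup_(n in [set n : nat | (1 <= n)%N]) iterated_ball e n x.

Definition bourbaki_quasi_cauchy (R : realType) (X : metricType R) (x : nat -> X) : Prop :=
  forall e : R, 0 < e ->
    exists (n0 : nat) (p : X),
      forall n : nat, (n0 <= n)%N -> infinite_ball e p (x n).

Definition subsequence_of (T : Type) (x y : nat -> T) : Prop :=
  exists phi : nat -> nat, increasing_seq phi /\ x = y \o phi.

(* Main.v *)
Require Import Defs.
From mathcomp Require Import all_boot all_order all_algebra.
From mathcomp Require Import all_classical all_reals all_analysis.
From mathcomp Require Import unstable.

(** For a Bourbaki quasi-Cauchy sequence, any two late enough terms are joined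
    by an [e]-chain, since chains can be reversed and concatenated. Joining
    [x n] to [x n.+1] by a chain that is as fine as possible among the meshes
    [1/(k+1)], [k <= n], and concatenating all these chains, gives a
    quasi-Cauchy sequence that runs through the terms of [x] in order. *)

Set Implicit Arguments.
Unset Strict Implicit.
Unset Printing Implicit Defensive.

Import Order.TTheory GRing.Theory Num.Theory.

Local Open Scope classical_set_scope.
Local Open Scope ring_scope.

Definition close (R : realType) (X : metricType R) (e : R) : rel X :=
  [rel a b | mdist a b < e].

Lemma path_close_rev (R : realType) (X : metricType R) (e : R) (a : X) s :
  path (close e) a s -> path (close e) (last a s) (rev (belast a s)).
Proof.
rewrite rev_path; apply: sub_path => u v.
by rewrite /close /= metric_sym.
Qed.

Lemma iterated_ball_path (R : realType) (X : metricType R) (e : R) n (p a : X) :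
  iterated_ball e n p a ->
  exists s, [/\ (0 < size s)%N, path (close e) p s & last p s = a].
Proof.
rewrite /iterated_ball; elim: n.-1 a => [|m IHm] a /=.
  by rewrite ballEmdist => /= pa; exists [:: a]; split; rewrite //= andbT.
move=> [b /IHm[s [s0 ps <-]]]; rewrite ballEmdist => /= ba.
exists (rcons s a); split; rewrite ?size_rcons ?last_rcons //.
by rewrite rcons_path ps.
Qed.

(** Walk back from [a] to the centre [p] along a reversed chain, then out to [b]. Requiring a
    nonempty chain even when [a = b] later makes the positions of the [x n] strictly increase. *)
Lemma infinite_ball_path (R : realType) (X : metricType R) (e : R) (p a b : X) :
  infinite_ball e p a -> infinite_ball e p b ->
  exists s, [/\ (0 < size s)%N, path (close e) a s & last a s = b].
Proof.
move=> [n _ /iterated_ball_path[s [s0 ps <-]]].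
move=> [m _ /iterated_ball_path[t [t0 pt <-]]].
have lastr : last (last p s) (rev (belast p s)) = p.
  by case: s s0 {ps} => //= c s _; rewrite rev_cons last_rcons.
exists (rev (belast p s) ++ t); split.
- by rewrite size_cat addn_gt0 t0 orbT.
- by rewrite cat_path path_close_rev //= lastr.
- by rewrite last_cat lastr.
Qed.

Lemma infinite_ball_center (R : realType) (X : metricType R) (e : R) (p : X) :
  0 < e -> infinite_ball e p p.
Proof. by move=> e0; exists 1%N => //; exact: ballxx. Qed.

Lemma infinite_ball_step (R : realType) (X : metricType R) (e : R) (p a b : X) :
  infinite_ball e p a -> mdist a b < e -> infinite_ball e p b.
Proof.
move=> [[//|n] _ pa] ab; exists n.+2 => //; exists a => //.
by rewrite ballEmdist.
Qed.

Lemma subsequence_bourbaki_quasi_cauchy (R : realType) (X : metricType R)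
    (x y : nat -> X) :
  quasi_cauchy y -> subsequence_of x y -> bourbaki_quasi_cauchy x.
Proof.
move=> qy [phi [phi_incr ->]] e e0; have [n0 yn0] := qy e e0.
exists n0, (y n0) => n n0n /=.
(* A strictly increasing map on the naturals dominates the identity; then [y] is followed step by
   step from [n0] to [phi n]. *)
have {n0n} n0phi : (n0 <= phi n)%N.
  by rewrite (leq_trans n0n)// mono_leq_infl.
rewrite -(subnKC n0phi); elim: (phi n - n0)%N => [|k IHk].
  by rewrite addn0; exact: infinite_ball_center.
rewrite addnS; apply: (infinite_ball_step IHk).
by rewrite metric_sym yn0 // leq_addr.
Qed.

(** A chain of mesh [1/(k+1)] is also one for every coarser mesh, so the chain for the largest
    feasible [k <= m] serves all [k] at once. The condition on each [k] leaves the lemma free of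
    hypotheses, so that choice applies for every index. *)
Lemma finest_path (R : realType) (X : metricType R) (a b : X) (m : nat) :
  exists s, [/\ (0 < size s)%N, last a s = b &
    forall k, (k <= m)%N ->
      (exists t, [/\ (0 < size t)%N, path (close k.+1%:R^-1) a t & last a t = b]) ->
      path (close (k.+1%:R^-1 : R)) a s].
Proof.
pose P k t := [/\ (0 < size t)%N, path (close (k.+1%:R^-1 : R)) a t & last a t = b].
elim: m => [|m [s [s0 las IHs]]].
  have [[t [t0 pt lat]]|nP] := pselect (exists t, P 0%N t).
    by exists t; split => // k; rewrite leqn0 => /eqP ->.
  (* No chain is fine enough: jump straight to [b], the mesh claim being vacuous. *)
  by exists [:: b]; split => // k; rewrite leqn0 => /eqP -> /nP.
have [[t [t0 pt lat]]|nP] := pselect (exists t, P m.+1 t).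
  exists t; split => // k km _; apply: sub_path pt => u v uv.
  by rewrite /close /= (lt_le_trans uv)// lef_pV2 ?posrE ?ltr0n// ler_nat.
exists s; split => // k; rewrite leq_eqVlt => /orP[/eqP -> /nP //|].
by rewrite ltnS; exact: IHs.
Qed.

Section Concatenation.
Variables (T : Type) (x : nat -> T) (s : nat -> seq T).
Hypothesis s_gt0 : forall n, (0 < size (s n))%N.
Hypothesis last_s : forall n, last (x n) (s n) = x n.+1.

(** The starting point [x n] is left out, so consecutive blocks join without repeating a point. *)
Definition block n m := flatten [seq s i | i <- iota n m].

(** Each chain is nonempty, so [j] of them together with [x 0] have more than [j] entries and the
    default of [nth] is never reached. *)
Definition concat j := nth (x 0) (x 0 :: block 0 j) j.

Lemma blockD n m k : block n (m + k) = block n m ++ block (n + m) k.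
Proof. by rewrite /block iotaD map_cat flatten_cat. Qed.

Lemma last_block n m : last (x n) (block n m) = x (n + m).
Proof.
elim: m n => [|m IHm] n; first by rewrite addn0.
by rewrite /block /= last_cat last_s IHm addSnnS.
Qed.

Lemma leq_size_block n m : (m <= size (block n m))%N.
Proof.
elim: m n => // m IHm n.
by rewrite /block /= size_cat -add1n leq_add // IHm.
Qed.

(** Of two initial blocks one is a prefix of the other, so any sufficiently long one gives the same
    entry. *)
Lemma concatE n j : (j <= size (block 0 n))%N ->
  concat j = nth (x 0) (x 0 :: block 0 n) j.
Proof.
have nth_block a b : (a <= b)%N -> (j <= size (block 0 a))%N ->
    nth (x 0) (x 0 :: block 0 b) j = nth (x 0) (x 0 :: block 0 a) j.
  by move=> /subnKC <- ja; rewrite blockD -cat_cons nth_cat /= ltnS ja.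
move=> jn; rewrite /concat; have [jn'|nj] := leqP j n.
  by rewrite (nth_block j n) // leq_size_block.
by rewrite (nth_block n j) // ltnW.
Qed.

Lemma concat_size_block n : concat (size (block 0 n)) = x n.
Proof. by rewrite (concatE (leqnn _)) (nth_last _ (x 0 :: _)) /= last_block. Qed.

Lemma size_block_increasing : increasing_seq (fun n => size (block 0 n)).
Proof.
apply: leq_mono => n m nm.
rewrite -(subnKC nm) addSnnS blockD size_cat -[ltnLHS]addn0 ltn_add2l.
exact: leq_trans (leq_size_block _ _).
Qed.

Lemma concat_subsequence : subsequence_of x concat.
Proof.
exists (fun n => size (block 0 n)); split; first exact: size_block_increasing.
by apply/funext => n /=; rewrite concat_size_block.
Qed.

Lemma concat_step (r : rel T) n0 :
  (forall n, (n0 <= n)%N -> path r (x n) (s n)) ->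
  forall j, (size (block 0 n0) <= j)%N -> r (concat j) (concat j.+1).
Proof.
move=> rs j n0j.
have path_block n m : (n0 <= n)%N -> path r (x n) (block n m).
  elim: m n => // m IHm n n0n; rewrite /block /= cat_path rs // last_s.
  by rewrite IHm // ltnW.
have jb : (j < size (block 0 (n0 + j.+1)))%N.
  by rewrite (leq_trans _ (leq_size_block _ _)) // leq_addl.
rewrite (concatE jb) (concatE (ltnW jb)).
move: jb; rewrite blockD size_cat -(subnKC n0j) ltn_add2l add0n => jb.
set i := (j - _)%N in jb *.
(* Past the first [n0] chains only the path issuing from [x n0] matters. For [i = 0] the entry is
   [x n0] itself, stored as the end of the preceding block. *)
have -> : nth (x 0) (x 0 :: block 0 n0 ++ block n0 (size (block 0 n0) + i).+1)
    (size (block 0 n0) + i) =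
    nth (x 0) (x n0 :: block n0 (size (block 0 n0) + i).+1) i.
  case: i {jb} => [|i].
    by rewrite addn0 -cat_cons nth_cat /= ltnSn (nth_last _ (x 0 :: _)) /= last_block.
  by rewrite addnS /= nth_cat ltnNge leq_addr /= addKn.
rewrite /= nth_cat ltnNge leq_addr /= addKn.
by move/(pathP (x 0)): (path_block n0 (size (block 0 n0) + i).+1 (leqnn _)); apply.
Qed.

End Concatenation.

Lemma bourbaki_quasi_cauchy_subsequence (R : realType) (X : metricType R)
    (x : nat -> X) :
  bourbaki_quasi_cauchy x ->
  exists y : nat -> X, quasi_cauchy y /\ subsequence_of x y.
Proof.
move=> bx.
have [s sP] := choice (fun n => finest_path (x n) (x n.+1) n).
have s0 n : (0 < size (s n))%N by have [] := sP n.
have ls n : last (x n) (s n) = x n.+1 by have [] := sP n.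
exists (concat x s); split; last exact: concat_subsequence.
move=> e e0.
have [k ke] : exists k : nat, k.+1%:R^-1 < e.
  by have [k _ /(_ k (leqnn k))] := near_infty_natSinv_lt (PosNum e0); exists k.
have [n0 [p xp]] : exists (n0 : nat) (p : X), forall n, (n0 <= n)%N ->
    infinite_ball (k.+1%:R^-1) p (x n) by apply: bx; rewrite invr_gt0 ltr0n.
(* Beyond [n0] a chain of mesh [1/(k+1)] from [x n] to [x n.+1] exists; beyond [k] that mesh is
   among those for which [s n] was optimised. *)
exists (size (block s 0 (maxn n0 k))) => j jn.
rewrite metric_sym (lt_trans _ ke) //.
apply: (concat_step s0 ls (r := close k.+1%:R^-1) _ jn) => n.
rewrite geq_max => /andP[n0n kn]; have [_ _] := sP n; apply => //.
by apply: infinite_ball_path (xp _ n0n) (xp _ _); rewrite leqW.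
Qed.

Theorem theorem2p1 (R : realType) (X : metricType R) (x : nat -> X) :
  bourbaki_quasi_cauchy x <->
  exists y : nat -> X, quasi_cauchy y /\ subsequence_of x y.
Proof.
split; first exact: bourbaki_quasi_cauchy_subsequence.
by move=> [y [qy xy]]; exact: subsequence_bourbaki_quasi_cauchy qy xy.
Qed.
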